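(* Let $(p,b_\bullet)$ be a polarised noncrossing partition. Then there exists a unique factorisation of the form $$(p,b_\bullet)=(\dots((\psi_0^0\circ_{i_1}\psi_{m_1}^{c_1})\circ_{i_2}\psi_{m_2}^{c_2})\dots)\circ_{i_k}\psi_{m_k}^{c_k}$$ with $i_1<\dots<i_k$, and, for all $j\in\{1,\dots,k\}$, either $m_j>0$ or $c_j=1$ (here $k\in\mathbb{N}$, $m_j\in\mathbb{N}$, $c_j\in\{0,1\}$, and $k=0$ gives $\psi_0^0$). Moreover, $\ell(p,b_\bullet)=\max\{0,i_1,\dots,i_k\}$, and $c_j=b_{i_j}$ for all $j\in\{1,\dots,k\}$.
   Context: Here $\mathbb{N}$ includes $0$ and $\mathbb{F}_2=\{0,1\}$ is the field with two elements (''bits'') with addition $\oplus$. Noncrossing partitions. A partition of degree $n$ is a partition $\{\pi_1,\dots,\pi_k\}$ of $\{1,\dots,n\}$ into non-empty blocks; it is noncrossing if for all $i,j$, all $a,a'\in\pi_i$, $b,b'\in\pi_j$, $a<b<a'<b'$ implies $i=j$. The empty partition $\{\}$ is the only partition of degree $0$. For $i,m\in\mathbb{N}$ let $\mathsf{s}_i^m\colon\mathbb{N}\to\mathbb{N}$ send $x\mapsto x$ if $x<i$ and $x\mapsto x+m$ if $x\ge i$. For noncrossing partitions $p=\{\pi_1,\dots,\pi_k\}$ of degree $n$, $q=\{\rho_1,\dots,\rho_\ell\}$ of degree $m$, and $i\in\{1,\dots,n+1\}$, set $p\circ_i q=\{\mathsf{s}_i^m(\pi_1),\dots,\mathsf{s}_i^m(\pi_k),\mathsf{s}_1^{i-1}(\rho_1),\dots,\mathsf{s}_1^{i-1}(\rho_\ell)\}$,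 a noncrossing partition of degree $n+m$. Polarised noncrossing partitions. A polarised noncrossing partition of degree $n$ is a pair $(p,b_1\cdots b_{n+1})$ (also written $(p,b_\bullet)$) of a noncrossing partition $p$ of degree $n$ and a string of $n+1$ bits. For $(p,b_\bullet)$ of degree $n$, $(q,c_\bullet)$ of degree $m$, $i\in\{1,\dots,n+1\}$, set $(p,b_\bullet)\circ_i(q,c_\bullet)=(p\circ_i q,\ b_1\cdots b_{i-1}(b_i\oplus c_1)\cdots(b_i\oplus c_{m+1})b_{i+1}\cdots b_{n+1})$. For $b\in\{0,1\}$ let $\psi_0^b=(\{\},b)$, and for $n>0$ let $\psi_n^b=(\{\{1,\dots,n\}\},b0\cdots0)$. Levels. The level $\ell_{\mathrm{NCP}}(p)$ of a noncrossing partition $p$ of degree $n$ is $0$ if $n=0$, and otherwise the maximum over the blocks $\pi$ of $p$ of $\min\pi$. The level of a bit string is $\ell_{\mathrm{B}}(b_1\cdots b_n)=\max(\{i\mid b_i=1\}\cup\{0\})$. The level of a polarised noncrossing partition is $\ell(p,b_\bullet)=\max\{\ell_{\mathrm{NCP}}(p),\ell_{\mathrm{B}}(b_\bullet)\}$. *)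

(* Defs.v *)
From HB Require Import structures.
From mathcomp Require Import all_boot all_order all_algebra finmap.

Set Implicit Arguments.
Unset Strict Implicit.
Unset Printing Implicit Defensive.

Local Open Scope fset_scope.
Local Open Scope nat_scope.

Notation bit := 'F_2.

Definition interval (n : nat) : {fset nat} := [fset x in iota 1 n].

Definition is_partition (n : nat) (p : {fset {fset nat}}) : Prop :=
  [/\ fset0 \notin p, trivIfset p & fcover p = interval n].

Definition noncrossing (p : {fset {fset nat}}) : Prop :=
  forall B C, B \in p -> C \in p ->
  forall a a' b b', a \in B -> a' \in B -> b \in C -> b' \in C ->
  a < b -> b < a' -> a' < b' -> B = C.

Definition shift (i m x : nat) : nat := if x < i then x else x + m.

Definition shift_part (i m : nat) (p : {fset {fset nat}}) : {fset {fset nat}} :=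
  [fset [fset shift i m x | x in B : {fset nat}] | B in p].

(* [m] is the degree of [q]; the formula does not involve the degree of [p]. *)
Definition ncp_comp (p : {fset {fset nat}}) (i m : nat)
    (q : {fset {fset nat}}) : {fset {fset nat}} :=
  shift_part i m p `|` shift_part 1 i.-1 q.

(* The fields are unconstrained, so that composites of all degrees live in one
   type without casts; well-formedness is [is_pncp]. *)
Record raw_pncp := PNCP {
  deg : nat;
  blocks : {fset {fset nat}};
  bits : seq bit
}.

Definition is_pncp (x : raw_pncp) : Prop :=
  [/\ is_partition (deg x) (blocks x), noncrossing (blocks x)
    & size (bits x) = (deg x).+1].

(* Bits are numbered from 1. *)
Definition bit_at (b : seq bit) (i : nat) : bit := nth 0%R b i.-1.

Definition bits_comp (b : seq bit) (i : nat) (c : seq bit) : seq bit :=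
  take i.-1 b ++ [seq (bit_at b i + cj)%R | cj <- c] ++ drop i b.

(* Meaningful only for 1 <= i <= (deg x).+1. *)
Definition pncp_comp (x : raw_pncp) (i : nat) (y : raw_pncp) : raw_pncp :=
  PNCP (deg x + deg y)
       (ncp_comp (blocks x) i (deg y) (blocks y))
       (bits_comp (bits x) i (bits y)).

Definition psi (n : nat) (b : bit) : raw_pncp :=
  PNCP n (if n == 0 then fset0 else [fset interval n]) (b :: nseq n 0%R).

(* The default [n] is neutral: it bounds the nonempty blocks of a partition of
   {1, ..., n}. *)
Definition block_min (n : nat) (B : {fset nat}) : nat :=
  \big[minn/n]_(x <- B) x.

Definition level_ncp (n : nat) (p : {fset {fset nat}}) : nat :=
  if n == 0 then 0 else \max_(B <- p) block_min n B.

Definition level_bits (b : seq bit) : nat :=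
  \max_(1 <= i < (size b).+1 | bit_at b i == 1%R) i.

Definition level (x : raw_pncp) : nat :=
  maxn (level_ncp (deg x) (blocks x)) (level_bits (bits x)).

(* A word [:: (i_1, m_1, c_1); ...; (i_k, m_k, c_k)] encodes the left-nested
   composite of the psi_(m_j)^(c_j) at the positions i_j. *)
Definition factor : Type := nat * nat * bit.

Definition comp_factor (x : raw_pncp) (f : factor) : raw_pncp :=
  let: (i, m, c) := f in pncp_comp x i (psi m c).

Fixpoint composable (x : raw_pncp) (s : seq factor) : bool :=
  if s is f :: s' then
    (1 <= f.1.1 <= (deg x).+1) && composable (comp_factor x f) s'
  else true.

Definition is_factorisation (x : raw_pncp) (s : seq factor) : Prop :=
  [/\ composable (psi 0 0%R) s,
      x = foldl comp_factor (psi 0 0%R) s,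
      sorted ltn [seq f.1.1 | f <- s]
    & forall i m c, (i, m, c) \in s -> 0 < m \/ c = 1%R].

(* Main.v *)
From Pilot Require Import Defs.
From HB Require Import structures.
From mathcomp Require Import all_boot all_order all_algebra finmap.
From mathcomp Require Import zify.

(** Composing a polarised partition [x] with [psi m c] at a position [i] strictly
    above the level of [x] is transparent.  Every block of [x] keeps its minimum,
    which is below [i]; a block {i, ..., i + m - 1} is added when [m > 0]; and
    since all bits of [x] from position [i] on vanish, the new bit string is the
    old one below [i], then [c], then zeros.  Hence, as soon as [0 < m] or
    [c = 1], the composite has level exactly [i] ([level_comp]), its bit at [i] is
    [c], and [x] is recovered by erasing the elements of {i, ..., i + m - 1} and
    clearing the bits from [i] on ([peelK]).  In a factorisation with increasing
    positions every composition is of this kind, because the level of each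
    partial composite is the last position used.  This gives the formula for the
    level and for the [c_j], as later factors do not change the bits at earlier
    positions ([factorisation_level]).

    Uniqueness: the last factor [(i, m, c)] is read off the composite: [i] is the
    level, [c] the bit at [i], and [m] the size of the block with minimum [i], or
    0 if there is no such block.  So composition at a position above the level is
    injective ([comp_factor_inj]), and factorisations are compared from the right.

    Existence: let [L > 0] be the level of [x].  If [L] is the minimum of a block,
    this block has no gap: the block of an element in a gap would have its
    minimum below [L], the largest of all minima, and would cross.  Thus it is
    {L, ..., L + m - 1} ([top_block]), and erasing it, together with the bits from
    [L] on, leaves a partition of smaller level of which [x] is a composite
    ([factor_top]).  Induction on the level concludes; at level 0 there are no
    blocks and no nonzero bits. *)

Set Implicit Arguments.
Unset Strict Implicit.
Unset Printing Implicit Defensive.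

Local Open Scope fset_scope.
Local Open Scope nat_scope.

(** * Segments, shifts and their inverses *)

(** The block that [psi m c] contributes at position [i]; it is empty for
    [m = 0], so that removing it from a set of nonempty blocks does nothing. *)
Definition seg (i m : nat) : {fset nat} := [fset x in iota i m].

Lemma mem_seg i m a : (a \in seg i m) = (i <= a < i + m).
Proof. by rewrite in_fset /= mem_iota. Qed.

Lemma mem_interval n a : (a \in Pilot.Defs.interval n) = (0 < a <= n).
Proof. exact: (mem_seg 1 n a). Qed.

Lemma seg_inj i m k : seg i m = seg i k -> m = k.
Proof.
move=> e; have := mem_seg i m (i + m); have := mem_seg i m (i + k).
by rewrite e !mem_seg; lia.
Qed.

Definition shift_set (i m : nat) (B : {fset nat}) : {fset nat} :=
  [fset shift i m a | a in B].

Definition unshift (i m a : nat) : nat := if a < i then a else a - m.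

Definition unshift_set (i m : nat) (B : {fset nat}) : {fset nat} :=
  [fset unshift i m a | a in B].

Lemma ltn_shift i m a b : (shift i m a < shift i m b) = (a < b).
Proof. by rewrite /shift; do 2![case: ifP]; lia. Qed.

Lemma shift_inj i m : injective (shift i m).
Proof. by move=> a b; rewrite /shift; do 2![case: ifP]; lia. Qed.

Lemma shiftK i m : cancel (shift i m) (unshift i m).
Proof. by move=> a; rewrite /shift /unshift; do 2![case: ifP]; lia. Qed.

(** The values of [shift i m] are exactly the numbers outside [seg i m]. *)
Lemma unshiftK i m a : a \notin seg i m -> shift i m (unshift i m a) = a.
Proof. by rewrite mem_seg /shift /unshift; do 2![case: ifP]; lia. Qed.

Lemma shift_notin_seg i m a : shift i m a \notin seg i m.
Proof. by rewrite mem_seg /shift; case: ifP; lia. Qed.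

Lemma mem_shift_set i m B a : (shift i m a \in shift_set i m B) = (a \in B).
Proof.
apply/imfsetP/idP => /= [[b bB /shift_inj-> //]|aB].
by exists a.
Qed.

Lemma shift_set_inj i m : injective (shift_set i m).
Proof.
by move=> B C e; apply/fsetP => a; rewrite -(mem_shift_set i m) e mem_shift_set.
Qed.

Lemma shift_setK i m : cancel (shift_set i m) (unshift_set i m).
Proof.
move=> B; apply/fsetP => a; apply/imfsetP/idP => /= [[b]|aB].
  by case/imfsetP => /= c cB -> ->; rewrite shiftK.
by exists (shift i m a); rewrite ?mem_shift_set ?shiftK.
Qed.

Lemma unshift_setK i m B :
  {in B, forall a, a \notin seg i m} -> shift_set i m (unshift_set i m B) = B.
Proof.
move=> dB; apply/fsetP => a; apply/imfsetP/idP => /= [[b]|aB].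
  by case/imfsetP => /= c cB -> ->; rewrite unshiftK ?dB.
exists (unshift i m a); last by rewrite unshiftK ?dB.
by apply/imfsetP; exists a.
Qed.

(** * Composites at a position above the level *)

Lemma bitP (b : bit) : b = 0%R \/ b = 1%R.
Proof. by case: b => [[|[|k]] ltk] //; [left|right]; apply/val_inj. Qed.

Lemma eq_bits (b b' : seq bit) :
  size b = size b' ->
  (forall j, 0 < j -> bit_at b j = bit_at b' j) -> b = b'.
Proof. by move=> es eb; apply: (eq_from_nth (x0 := 0%R)) es _ => j _; apply: (eb j.+1). Qed.

Lemma comp_blocksP x i m c B :
  0 < i ->
  reflect ((exists2 C, C \in blocks x & B = shift_set i m C) \/
           (0 < m /\ B = seg i m))
    (B \in blocks (comp_factor x (i, m, c))).
Proof.
move=> i0; have seg_shift : shift_set 1 i.-1 (seg 1 m) = seg i m.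
  apply/fsetP => a; rewrite mem_seg; apply/imfsetP/idP => /=.
    by case=> b; rewrite mem_seg /shift => bm ->; case: ifP; lia.
  move=> am; exists (a - i.-1); rewrite ?mem_seg /shift; last case: ifP; lia.
rewrite /= /ncp_comp in_fsetU.
apply: (iffP orP) => -[].
- by case/imfsetP => /= C CB ->; left; exists C.
- case/imfsetP => /= C; case: ifP => m0; first by rewrite inE.
  by rewrite inE => /eqP-> ->; right; split; rewrite ?lt0n ?m0 //; exact: seg_shift.
- by case=> C CB ->; left; apply/imfsetP; exists C.
- case=> m0 ->; right; apply/imfsetP; exists (seg 1 m) => /=.
    by rewrite -if_neg -lt0n m0 inE.
  by rewrite -[LHS]seg_shift.
Qed.

Lemma size_comp_bits x i m c :
  size (bits x) = (deg x).+1 -> 0 < i <= (deg x).+1 ->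
  size (bits (comp_factor x (i, m, c))) = (deg x + m).+1.
Proof.
move=> sx ix; rewrite /= /bits_comp !size_cat size_map /= size_nseq.
by rewrite size_drop size_take sx; case: ifP; lia.
Qed.

(** Adding the bit of [x] at [i] to the bits of [psi m c] has no effect, since it is
    among the bits assumed to vanish. *)
Lemma comp_bit_at x i m c j :
  size (bits x) = (deg x).+1 -> 0 < i <= (deg x).+1 ->
  (forall k, i <= k -> bit_at (bits x) k = 0%R) -> 0 < j ->
  bit_at (bits (comp_factor x (i, m, c))) j =
    if j < i then bit_at (bits x) j else if j == i then c else 0%R.
Proof.
move=> sx ix bx j0; rewrite /= /bits_comp [LHS]/bit_at nth_cat size_take_min.
rewrite (minn_idPl _) ?sx; last lia.
have -> : (j.-1 < i.-1) = (j < i) by lia.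
case: ifP => ji; first by rewrite nth_take //; lia.
rewrite bx //= map_nseq !GRing.add0r.
case: eqP => [->|ne]; first by rewrite subnn.
have [d ->] : exists d, j.-1 - i.-1 = d.+1 by exists (j.-1 - i.-1).-1; lia.
rewrite /= nth_cat size_nseq nth_nseq; case: ifP => dm; first by rewrite dm.
by rewrite nth_drop; apply: (bx (i + (d - m)).+1); lia.
Qed.

(** The part of well-formedness that makes levels meaningful.  It is preserved by
    composition for simple reasons, whereas disjointness and noncrossingness
    would have to be re-established for every composite. *)
Definition confined (x : raw_pncp) : Prop :=
  (forall B, B \in blocks x ->
     B != fset0 /\ {in B, forall a, 0 < a <= deg x}) /\
  size (bits x) = (deg x).+1.

Lemma is_pncp_confined x : is_pncp x -> confined x.
Proof.
case=> -[n0 _ cov] _ sz; split=> // B Bx; split.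
  by apply: contraNneq n0 => <-.
move=> a aB; rewrite -mem_interval -cov.
by apply/bigfcupP; exists B; rewrite ?Bx.
Qed.

Lemma comp_confined x i m c :
  confined x -> 0 < i <= (deg x).+1 -> confined (comp_factor x (i, m, c)).
Proof.
case=> bx sx ix; split; last exact: size_comp_bits.
move=> B /comp_blocksP[|[C /bx[/fset0Pn[a aC] bC] ->]|[m0 ->]]; first lia.
  split; first by apply/fset0Pn; exists (shift i m a); rewrite mem_shift_set.
  move=> _ /imfsetP[/= b /bC bn ->]; rewrite /shift.
  by case: ifP; lia.
split; first by apply/fset0Pn; exists i; rewrite mem_seg; lia.
by move=> a; rewrite mem_seg /=; lia.
Qed.

(** * Levels *)

Lemma block_min_leP n k (B : {fset nat}) :
  B != fset0 -> {in B, forall a, a <= n} ->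
  (block_min n B <= k) <-> (exists2 a, a \in B & a <= k).
Proof.
move=> /fset0Pn[b bB] Bn; rewrite /block_min; split.
  have {}bB : b \in (B : seq nat) by [].
  have {}Bn : forall a, a \in (B : seq nat) -> a <= n by [].
  suff [a aB ->] : exists2 a, a \in (B : seq nat) & \big[minn/n]_(x <- B) x = a.
    by exists a.
  elim: (B : seq nat) b bB Bn => // a s IHs b _ Bn; rewrite big_cons.
  case: s IHs Bn => [|a' s] IHs Bn.
    by rewrite big_nil; exists a; rewrite ?inE // (minn_idPl _) // Bn ?inE ?eqxx.
  have [|a2 sa2 ->] := IHs a' (mem_head _ _).
    by move=> a2 sa2; rewrite Bn // inE sa2 orbT.
  case: (leqP a a2) => _; first by exists a; rewrite ?mem_head.
  by exists a2; rewrite // inE sa2 orbT.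
case=> a aB; apply: leq_trans.
have {}aB : a \in (B : seq nat) by [].
elim: (B : seq nat) aB => // a' s IHs; rewrite inE big_cons.
case/predU1P => [->|/IHs]; first exact: geq_minl.
exact/leq_trans/geq_minr.
Qed.

(** All levels below are computed through this description of the relation
    [level x <= k], which avoids handling the iterated maxima and minima. *)
Definition level_le (k : nat) (x : raw_pncp) : Prop :=
  (forall B, B \in blocks x -> exists2 a, a \in B & a <= k) /\
  (forall j, k < j -> bit_at (bits x) j = 0%R).

(** The special case of degree 0 in the level is absorbed: there are no blocks
    then, so the maximum is empty. *)
Lemma level_ncpE x :
  confined x ->
  level_ncp (deg x) (blocks x) = \max_(B <- blocks x) block_min (deg x) B.
Proof.
case=> bx _; rewrite /level_ncp; case: eqP => // dx; rewrite big_seq big1 // => B.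
by move/bx => [/fset0Pn[a aB] /(_ a aB)]; lia.
Qed.

Lemma level_leP k x : confined x -> (level x <= k) <-> level_le k x.
Proof.
move=> cx; rewrite /level geq_max level_ncpE //; case: cx => bx sx.
have minP B : B \in blocks x ->
    (block_min (deg x) B <= k) <-> (exists2 a, a \in B & a <= k).
  by case/bx => n0 Bn; apply: block_min_leP => // a /Bn /andP[].
split=> [/andP[/bigmax_leqP_seq lp /bigmax_leqP_seq lb]|[lp lb]].
  split=> [B Bx|j kj]; first by apply/minP => //; exact: lp.
  case: (bitP (bit_at (bits x) j)) => // bj.
  have jsz : j < (size (bits x)).+1.
    rewrite ltnNge; apply: contra_eqN (bj) => jsz.
    by rewrite /bit_at nth_default // -ltnS (ltn_predK kj).
  by have := lb j; rewrite mem_index_iota bj eqxx; lia.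
apply/andP; split; apply/bigmax_leqP_seq; first by move=> B Bx _; exact/minP/lp.
by move=> j _ /eqP bj; rewrite leqNgt; apply/negP => /lb; rewrite bj.
Qed.

(** The bound from below is where [0 < m] or [c = 1] matters: the new block has
    minimum [i], or the new bit at [i] is 1. *)
Lemma level_comp x i m c :
  confined x -> 0 < i <= (deg x).+1 -> level x < i -> 0 < m \/ c = 1%R ->
  level (comp_factor x (i, m, c)) = i.
Proof.
move=> cx ix lx mc.
have [lb lbit] : level_le i.-1 x by apply/level_leP => //; lia.
have bx k : i <= k -> bit_at (bits x) k = 0%R by move=> ik; apply: lbit; lia.
have cy := comp_confined m c cx ix; have [_ sx] := cx.
have i0 : 0 < i by lia.
apply/eqP; rewrite eqn_leq; apply/andP; split.
  apply/level_leP => //; split=> [B|j ij]; last first.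
    have j0 : 0 < j by lia.
    by rewrite comp_bit_at // ltnNge (ltnW ij) gtn_eqF.
  case/(comp_blocksP x m c B i0) => [[C /lb[a aC ai] ->]|[m0 ->]].
    by exists (shift i m a); rewrite ?mem_shift_set // /shift; case: ifP; lia.
  by exists i; rewrite ?mem_seg; lia.
rewrite leqNgt; apply/negP => ly.
have /(level_leP _ cy)[yb ybit] : level (comp_factor x (i, m, c)) <= i.-1 by lia.
case: mc => [m0|c1].
  have /yb[a] : seg i m \in blocks (comp_factor x (i, m, c)).
    by apply/comp_blocksP => //; right.
  by rewrite mem_seg; lia.
have := ybit i; rewrite comp_bit_at // ltnn eqxx c1 => /(_ _) e.
by have /e : i.-1 < i by lia.
Qed.

(** * Removing the last factor *)

(** The left inverse of [comp_factor^~ (i, m, c)] on partitions of level below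
    [i].  Such a partition of degree [deg x - m] has only zeros at the
    [deg x - m + 2 - i] positions from [i] to [deg x - m + 1]. *)
Definition peel (i m : nat) (x : raw_pncp) : raw_pncp :=
  PNCP (deg x - m)
       [fset unshift_set i m B | B in blocks x `\ seg i m]
       (take i.-1 (bits x) ++ nseq (deg x - m + 2 - i) 0%R).

Lemma peel_bit_at x i m j :
  size (bits x) = (deg x).+1 -> 0 < i -> i + m <= (deg x).+1 -> 0 < j ->
  bit_at (bits (peel i m x)) j = if j < i then bit_at (bits x) j else 0%R.
Proof.
move=> sx i0 im j0; rewrite /= [LHS]/bit_at nth_cat size_take_min.
rewrite (minn_idPl _) ?sx; last lia.
have -> : (j.-1 < i.-1) = (j < i) by lia.
by case: ifP => ji; [rewrite nth_take //; lia | rewrite nth_nseq if_same].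
Qed.

Lemma size_peel_bits x i m :
  size (bits x) = (deg x).+1 -> 0 < i -> i + m <= (deg x).+1 ->
  size (bits (peel i m x)) = (deg (peel i m x)).+1.
Proof.
by move=> sx i0 im; rewrite /= size_cat size_nseq size_take_min sx /minn; case: ifP; lia.
Qed.

Lemma raw_pncp_eq x y :
  deg x = deg y -> blocks x = blocks y -> bits x = bits y -> x = y.
Proof. by case: x => n p b; case: y => m q c /= -> -> ->. Qed.

(** A shifted block of [x] still has an element below [i], so it is never the block
    [seg i m] that peeling removes. *)
Lemma peelK x i m c :
  confined x -> 0 < i <= (deg x).+1 -> level x < i ->
  peel i m (comp_factor x (i, m, c)) = x.
Proof.
move=> cx ix lx; have cy := comp_confined m c cx ix; have [bx sx] := cx.
have [lb lbit] : level_le i.-1 x by apply/level_leP => //; lia.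
have i0 : 0 < i by lia.
have zx k : i <= k -> bit_at (bits x) k = 0%R by move=> ik; apply: lbit; lia.
have sy : size (bits (comp_factor x (i, m, c))) = (deg x + m).+1 by case: cy.
apply: raw_pncp_eq; first exact: addnK.
  apply/fsetP => B; apply/imfsetP/idP => /= [[C]|Bx].
    rewrite in_fsetD1 => /andP[Cs /(comp_blocksP x m c C i0)[[D Dx eC] ->|[_ eC]]].
      by rewrite eC shift_setK.
    by rewrite eC eqxx in Cs.
  exists (shift_set i m B); last by rewrite shift_setK.
  rewrite in_fsetD1; apply/andP; split; last first.
    by apply/comp_blocksP => //; left; exists B.
  have [a aB _] := lb B Bx.
  apply: contraTneq (shift_notin_seg i m a) => <-.
  by rewrite negbK mem_shift_set.
apply: eq_bits => [|j j0].
  by rewrite size_peel_bits //= ?sx ?addnK //; lia.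
rewrite peel_bit_at //=; last lia.
by case: ifP => ji; [rewrite comp_bit_at // ji | rewrite zx //; lia].
Qed.

(** Only the factor can contribute a block with minimum [i]; this determines the
    degree of the factor. *)
Lemma seg_comp_size x i m k c :
  confined x -> 0 < i -> level x < i -> 0 < k ->
  seg i k \in blocks (comp_factor x (i, m, c)) -> k = m.
Proof.
move=> cx i0 lx k0.
have [lb _] : level_le i.-1 x by apply/level_leP => //; lia.
case/comp_blocksP => // [[C /lb[a aC ai] e]|[_ /seg_inj //]].
have : shift i m a \in seg i k by rewrite e mem_shift_set.
by rewrite mem_seg /shift; case: ifP; lia.
Qed.

(** The conditions under which [f] may follow a factorisation of [x], as the
    level of [x] is then the largest position used. *)
Definition admissible (x : raw_pncp) (f : factor) : Prop :=
  [/\ 0 < f.1.1 <= (deg x).+1, level x < f.1.1 & 0 < f.1.2 \/ f.2 = 1%R].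

(** The composite determines the factor (its level is the position, its bit there is
    the bit of the factor, and the block with that minimum, if any, gives the
    degree); then [peelK] recovers the first operand. *)
Lemma comp_factor_inj x y f g :
  confined x -> confined y -> admissible x f -> admissible y g ->
  comp_factor x f = comp_factor y g -> x = y /\ f = g.
Proof.
case: f g => [[i m] c] [[j k] d] cx cy [ix lx mc] [jy ly kd] e.
rewrite /= in ix lx mc jy ly kd.
have ij : i = j by rewrite -(level_comp cx ix lx mc) -(level_comp cy jy ly kd) e.
subst j.
have i0 : 0 < i by lia.
have bit_top z n a : confined z -> 0 < i <= (deg z).+1 -> level z < i ->
    bit_at (bits (comp_factor z (i, n, a))) i = a.
  move=> cz iz lz; rewrite comp_bit_at ?ltnn ?eqxx //; first by case: cz.
  have [_ lbit] : level_le i.-1 z by apply/level_leP => //; lia.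
  by move=> l il; apply: lbit; lia.
have cd : c = d by rewrite -(bit_top x m c) // e bit_top.
have mk : m = k.
  case: (posnP m) => [m0|m0].
    case: (posnP k) => [->//|k0]; apply/esym/(seg_comp_size cx i0 lx k0 (c := c)).
    by rewrite e; apply/comp_blocksP => //; right.
  apply: (seg_comp_size cy i0 ly m0 (c := d)).
  by rewrite -e; apply/comp_blocksP => //; right.
split; last by rewrite cd mk.
by rewrite -(peelK m c cx ix lx) e -cd -mk; subst k; rewrite peelK.
Qed.

(** * The block of largest minimum *)

Lemma is_pncp_disjoint x B C a :
  is_pncp x -> B \in blocks x -> C \in blocks x -> a \in B -> a \in C -> B = C.
Proof.
case=> -[_ /trivIfsetP tx _] _ _ Bx Cx aB aC; apply/eqP.
apply: contraTT aC => nBC; exact: (fdisjointP (tx B C Bx Cx nBC)).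
Qed.

(** Here [m] is 0 when no block has minimum [level x]; the level then comes from
    the bits.  Otherwise [seg (level x) m] is the block with that minimum, and it
    is a segment: an element [a] strictly inside it but in another block [C]
    would cross it, because the minimum of [C] is below [level x]. *)
Lemma top_block x :
  is_pncp x -> 0 < level x ->
  exists m, [/\ level x + m <= (deg x).+1,
                0 < m -> seg (level x) m \in blocks x,
                0 < m \/ bit_at (bits x) (level x) = 1%R
              & forall B, B \in blocks x -> B != seg (level x) m ->
                  exists2 a, a \in B & a < level x].
Proof.
move=> hx; have cx := is_pncp_confined hx; have [bx sx] := cx.
move eL: (level x) => L L0.
have [lb lbit] : level_le L x by apply/level_leP => //; rewrite eL.
case: (boolP (has (fun B : {fset nat} => ~~ has (fun a => a < L) B) (blocks x))).
  case/hasP => /= B Bx /hasPn/= geB.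
  have LB : L \in B.
    have [a aB aL] := lb B Bx.
    by have <- : a = L by have := geB a aB; lia.
  have [n0 Bn] := bx B Bx.
  have exB : exists a, a \in B by exists L.
  have leB a : a \in B -> a <= deg x by move=> /Bn /andP[].
  case: (ex_maxnP exB leB) => M MB leM.
  (* B is the segment from its minimum L to its maximum M. *)
  have LM := leM _ LB; have := Bn M MB => Mn.
  have eB : B = seg L (M - L).+1.
    apply/fsetP => a; rewrite mem_seg; apply/idP/idP => [aB|aLM].
      by have := leM a aB; have := geB a aB; lia.
    have : a \in fcover (blocks x).
      by case: hx => -[_ _ ->] _ _; rewrite mem_interval; lia.
    case/bigfcupP => C; rewrite andbT => Cx aC.
    case: (eqVneq C B) => [<- //|/eqP nCB].
    have [c cC cL] := lb C Cx.
    have cltL : c < L.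
      rewrite ltn_neqAle cL andbT; apply/eqP => ecL; apply: nCB.
      by apply: (is_pncp_disjoint hx Cx Bx cC); rewrite ecL.
    have aL : a != L.
      by apply/eqP => e; apply: nCB; apply: (is_pncp_disjoint hx Cx Bx aC); rewrite e.
    have aM : a != M.
      by apply/eqP => e; apply: nCB; apply: (is_pncp_disjoint hx Cx Bx aC); rewrite e.
    case: hx => _ nc _; case: nCB.
    (* c < L < a < M with c, a in C and L, M in B *)
    by apply: (nc _ _ Cx Bx c a L M) => //; lia.
  exists (M - L).+1; split=> //; [lia | by rewrite -eB | by left |].
  move=> C Cx /eqP nCB; have [c cC cL] := lb C Cx.
  exists c => //; rewrite ltn_neqAle cL andbT; apply/eqP => ecL; apply: nCB.
  by rewrite -eB; apply: (is_pncp_disjoint hx Cx Bx cC); rewrite ecL.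
move/hasPn => /= ltB.
have lowB B : B \in blocks x -> exists2 a, a \in B & a < L.
  by move/ltB; rewrite negbK => /hasP.
have bL : bit_at (bits x) L = 1%R.
  case: (bitP (bit_at (bits x) L)) => // bL.
  suff : level x <= L.-1 by lia.
  apply/level_leP => //; split=> [B /lowB[a aB aL]|j Lj]; first by exists a; lia.
  by case: (eqVneq j L) => [->//|jL]; apply: lbit; lia.
exists 0; split=> //; [|by right|by move=> B /lowB].
rewrite addn0 -sx leqNgt; apply: contra_eqN (bL) => szL.
by rewrite /bit_at nth_default // -ltnS (ltn_predK L0).
Qed.

Lemma peel_blocksP x i m B :
  (forall C, C \in blocks x -> C != seg i m -> [disjoint C & seg i m]) ->
  (B \in blocks (peel i m x)) =
    (shift_set i m B != seg i m) && (shift_set i m B \in blocks x).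
Proof.
move=> dx; apply/imfsetP/andP => /= [[C]|[nB Bx]].
  rewrite in_fsetD1 => /andP[nC Cx] ->.
  by rewrite unshift_setK //; exact/fdisjointP/dx.
by exists (shift_set i m B); rewrite ?in_fsetD1 ?nB // shift_setK.
Qed.

(** All properties of the peeled partition are read off [x] along [shift], which is
    increasing and maps {1, ..., deg x - m} onto {1, ..., deg x} with
    [seg (level x) m] removed. *)
Lemma factor_top x :
  is_pncp x -> 0 < level x ->
  exists y f, [/\ is_pncp y, admissible y f, f.1.1 = level x & x = comp_factor y f].
Proof.
move=> hx L0; have cx := is_pncp_confined hx; have [bx sx] := cx.
have [m [Lm segx mbit lowx]] := top_block hx L0.
move eL: (level x) L0 Lm segx mbit lowx => L L0 Lm segx mbit lowx.
have dx C : C \in blocks x -> C != seg L m -> [disjoint C & seg L m].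
  move=> Cx nC; apply/fdisjointP => a aC; apply: contraNN nC => aS; apply/eqP.
  apply: (is_pncp_disjoint hx Cx _ aC aS); apply: segx.
  by move: aS; rewrite mem_seg; lia.
have blP B := peel_blocksP B dx.
set y := peel L m x in blP *.
have [[n0 _ cov] nc _] := hx.
have hy : is_pncp y.
  split; last exact: size_peel_bits.
    split.
    - rewrite blP; apply/negP => /andP[_].
      have -> : shift_set L m fset0 = fset0.
        by apply/fsetP => a; apply/imfsetP => -[].
      exact/negP.
    - apply/trivIfsetP => B C; rewrite !blP => /andP[_ Bx] /andP[_ Cx].
      move=> nBC; apply/fdisjointP => a aB; apply: contraNN nBC => aC.
      apply/eqP/(@shift_set_inj L m)/(is_pncp_disjoint hx Bx Cx (a := shift L m a));
      by rewrite mem_shift_set.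
    apply/fsetP => a; rewrite mem_interval /=; apply/bigfcupP/idP => /=.
      case=> B; rewrite andbT blP => /andP[nB Bx] aB.
      have /(fdisjointP (dx _ Bx nB)) : shift L m a \in shift_set L m B.
        by rewrite mem_shift_set.
      have [_ /(_ (shift L m a))] := bx _ Bx; rewrite mem_shift_set mem_seg.
      by move=> /(_ aB); rewrite /shift; case: ifP; lia.
    move=> an; have : shift L m a \in fcover (blocks x).
      by rewrite cov mem_interval /shift; case: ifP; lia.
    case/bigfcupP => C; rewrite andbT => Cx aC.
    have nC : C != seg L m.
      by apply: contraTneq aC => ->; exact: shift_notin_seg.
    have eC : shift_set L m (unshift_set L m C) = C.
      by apply: unshift_setK; exact/fdisjointP/dx.
    exists (unshift_set L m C); first by rewrite andbT blP eC nC.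
    by rewrite -(mem_shift_set L m) eC.
  move=> B C; rewrite !blP => /andP[_ Bx] /andP[_ Cx] a a' b b' aB a'B bC b'C ab ba' ab'.
  apply: (@shift_set_inj L m).
  by apply: (nc _ _ Bx Cx (shift L m a) (shift L m a') (shift L m b) (shift L m b'));
    rewrite ?mem_shift_set ?ltn_shift.
have cy := is_pncp_confined hy.
have Ly : 0 < L <= (deg y).+1 by rewrite /=; lia.
have lvy : level_le L.-1 y.
  split=> [B|j Lj]; last by rewrite peel_bit_at //; [case: ifP => //; lia | lia].
  rewrite blP => /andP[nB Bx]; have [_ /imfsetP[a aB ->]] := lowx _ Bx nB.
  by rewrite /shift; case: ifP => aL; [exists a => //; lia | lia].
exists y, (L, m, bit_at (bits x) L); split=> //.
  by split=> //=; rewrite -(ltn_predK L0) ltnS; exact/level_leP.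
have cz := comp_confined m (bit_at (bits x) L) cy Ly.
apply: raw_pncp_eq; first by rewrite /=; lia.
  apply/fsetP => B; apply/idP/comp_blocksP => // [Bx|[[C]|[m0 ->]]]; last exact: segx.
    case: (eqVneq B (seg L m)) => [eB|nB].
      right; split=> //; rewrite lt0n; apply: contraNneq n0 => m0.
      suff <- : B = fset0 by [].
      by apply/fsetP => a; rewrite eB mem_seg m0 inE; lia.
    have eB : shift_set L m (unshift_set L m B) = B.
      by apply: unshift_setK; exact/fdisjointP/dx.
    by left; exists (unshift_set L m B); rewrite ?blP ?eB ?nB.
  by rewrite blP => /andP[_ Cx] ->.
have [_ ybit] := lvy.
have yz k : L <= k -> bit_at (bits y) k = 0%R by move=> Lk; apply: ybit; lia.
apply: eq_bits => [|j j0].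
  by case: cz => _ ->; rewrite sx /=; lia.
have [_ sy] := cy.
have [_ lbit] : level_le L x by apply/level_leP => //; rewrite eL.
rewrite comp_bit_at // peel_bit_at //; case: ltngtP => // [Lj|->//].
by rewrite lbit.
Qed.

(** * Factorisations *)

Lemma level0_psi x : is_pncp x -> level x = 0 -> x = psi 0 0%R.
Proof.
move=> hx lx; have cx := is_pncp_confined hx; have [bx sx] := cx.
have [lb lbit] : level_le 0 x by apply/level_leP => //; rewrite lx.
have b0 : blocks x = fset0.
  apply/fsetP => B; rewrite inE; apply/negP => Bx.
  by have [a aB] := lb B Bx; have [_ /(_ a aB)] := bx B Bx; lia.
have d0 : deg x = 0.
  case: hx => -[_ _ cov] _ _; have := mem_interval (deg x) (deg x).
  rewrite -cov b0 /fcover big_seq_fset0 inE; lia.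
apply: raw_pncp_eq => //; apply: eq_bits; first by rewrite sx d0.
by move=> j j0; rewrite lbit // /bit_at /=; case: j.-1 => //= k; rewrite nth_nil.
Qed.

Lemma composable_rcons x s f :
  composable x (rcons s f) =
    composable x s && (1 <= f.1.1 <= (deg (foldl comp_factor x s)).+1).
Proof. by elim: s x => [|g s IHs] x /=; rewrite ?andbT // IHs andbA. Qed.

(** Factorisations are analysed from the right, where the position is largest;
    the increasing positions become a bound on those of the initial factors. *)
Lemma factorisation_rcons x s f :
  is_factorisation x (rcons s f) <->
  exists y, [/\ is_factorisation y s, x = comp_factor y f,
                0 < f.1.1 <= (deg y).+1, {in s, forall g, g.1.1 < f.1.1}
              & 0 < f.1.2 \/ f.2 = 1%R].
Proof.
rewrite /is_factorisation composable_rcons foldl_rcons map_rcons.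
rewrite !(sorted_pairwise ltn_trans) pairwise_rcons all_map; split.
  case=> /andP[cs fi] -> /andP[/allP lts ps] ad.
  exists (foldl comp_factor (psi 0 0%R) s); split=> //.
    by split=> // i m c ims; apply: (ad i); rewrite mem_rcons inE ims orbT.
  by case: f {fi lts} ad => [[i m] c] /(_ i m c); apply; rewrite mem_rcons mem_head.
case=> y [[cs ey ps ad] -> fi lts fad]; split.
- by rewrite cs -ey.
- by rewrite ey.
- by rewrite ps andbT; apply/allP.
move=> i m c; rewrite mem_rcons inE => /predU1P[ef|]; last exact: ad.
by move: fad; rewrite -ef.
Qed.

Lemma psi0_pncp : is_pncp (psi 0 0%R).
Proof.
split=> //; split; rewrite ?inE //; first by apply/trivIfsetP => B C; rewrite inE.
by apply/fsetP => a; rewrite mem_interval /fcover big_seq_fset0 in_fset0 /=; lia.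
Qed.

Lemma level_psi0 : level (psi 0 0%R) = 0.
Proof.
apply/eqP; rewrite -leqn0; apply/level_leP.
  exact/is_pncp_confined/psi0_pncp.
split=> [B|j j0]; first by rewrite inE.
by rewrite /bit_at /=; case: j.-1 => //= k; rewrite nth_nil.
Qed.

Lemma max_position_lt (s : seq factor) n :
  0 < n -> {in s, forall g, g.1.1 < n} <-> \max_(g <- s) g.1.1 < n.
Proof.
move=> n0; rewrite -(ltn_predK n0) ltnS; split=> [lts|/bigmax_leqP_seq lts g gs].
  by apply/bigmax_leqP_seq => g gs _; have := lts g gs; rewrite ltnS.
by rewrite ltnS; exact: lts.
Qed.

(** By induction from the right: the level of the composite of the initial factors
    is their largest position, so it lies below the position of the last factor
    and [level_comp] applies.  Positivity of the positions is part of the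
    induction because [bit_at] identifies positions 0 and 1. *)
Lemma factorisation_level x s :
  is_factorisation x s ->
  [/\ confined x, level x = \max_(f <- s) f.1.1
    & forall i m c, (i, m, c) \in s -> 0 < i /\ c = bit_at (bits x) i].
Proof.
elim/last_ind: s x => [|s f IHs] x.
  by case=> _ /= -> _ _; rewrite big_nil level_psi0; split;
    first exact: is_pncp_confined psi0_pncp.
case/factorisation_rcons => y [/IHs[cy ly ybits] -> fi lts fad].
have f0 : 0 < f.1.1 by case/andP: fi.
have lyf : level y < f.1.1 by rewrite ly; apply/max_position_lt.
case: f => [[i m] c] /= in fi lts fad f0 lyf *.
have [_ ybit] : level_le i.-1 y by apply/level_leP => //; lia.
have [_ sy] := cy.
have bitz j : 0 < j -> bit_at (bits (comp_factor y (i, m, c))) j =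
    if j < i then bit_at (bits y) j else if j == i then c else 0%R.
  by move=> j0; apply: comp_bit_at => // k ik; apply: ybit; lia.
split; first exact: comp_confined.
  rewrite (level_comp cy fi lyf fad) big_rcons /= -ly.
  by apply/esym/maxn_idPr; lia.
move=> j n d; rewrite mem_rcons inE => /predU1P[[-> _ ->]|js].
  by rewrite bitz // ltnn eqxx.
have ji := lts _ js; rewrite /= in ji.
have [j0 ->] := ybits _ _ _ js.
by rewrite bitz // ji.
Qed.

Lemma factorisation_unique x s t :
  is_factorisation x s -> is_factorisation x t -> s = t.
Proof.
have last_fact z u f : is_factorisation z (rcons u f) ->
    exists y, [/\ is_factorisation y u, confined y, admissible y f & z = comp_factor y f].
  case/factorisation_rcons => y [fy -> fi lts fad]; exists y.
  have [cy ly _] := factorisation_level fy; split=> //; split=> //.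
  by rewrite ly; apply/max_position_lt => //; case/andP: fi.
have nil_rcons z u f : is_factorisation z [::] -> ~ is_factorisation z (rcons u f).
  case=> _ /= -> _ _ fu; have [_ + _] := factorisation_level fu.
  case/factorisation_rcons: fu => y [_ _ /andP[f0 _] _ _].
  by rewrite level_psi0 big_rcons /=; lia.
elim/last_ind: s x t => [|s f IHs] x t.
  by case/lastP: t => // t g /nil_rcons h /h.
case/lastP: t => [hs /nil_rcons/(_ hs) //|t g].
case/last_fact => y [fy cy af ->] /last_fact[z [fz cz ag]] e.
have [yz <-] := comp_factor_inj cy cz af ag e.
by rewrite (IHs y t) // yz.
Qed.

Lemma factorisation_exists x : is_pncp x -> exists s, is_factorisation x s.
Proof.
move eL: (level x) => L; elim/ltn_ind: L x eL => L IHL x eL hx.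
case: (posnP L) => [L0|L0].
  exists [::]; split=> //=.
  by apply: level0_psi; rewrite // eL.
have [|y [f [hy [fi lyf fad] ef ex]]] := factor_top hx; first by rewrite eL.
rewrite ef eL in lyf.
have [s fs] := IHL _ lyf y erefl hy.
have [_ ly _] := factorisation_level fs.
exists (rcons s f); apply/factorisation_rcons; exists y; split=> //.
by apply/max_position_lt; rewrite ?ef ?eL // -ly.
Qed.

Theorem proposition1p16 (x : raw_pncp) (hx : is_pncp x) :
  (exists! s : seq factor, is_factorisation x s) /\
  (forall s : seq factor, is_factorisation x s ->
     level x = \max_(f <- s) f.1.1 /\
     (forall (i m : nat) (c : bit), (i, m, c) \in s -> c = bit_at (bits x) i)).
Proof.
split; last by move=> s /factorisation_level[_ lx bx]; split=> // i m c /bx[].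
have [s fs] := factorisation_exists hx.
by exists s; split=> // t; exact: factorisation_unique.
Qed.
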